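(* Let $(G,X,x_0)$ be a $0$-dimensional ambit. If the $G$-ambit $X$ has sep. fin. EDRdeg, then the Ellis group of $X$ is profinite.
   Context: Compact spaces are Hausdorff. A flow $(G,X)$ is a topological group $G$ acting continuously on a compact space $X$. An ambit $(G,X,x_0)$ is a flow with a distinguished point $x_0\in X$ whose orbit is dense; it is $0$-dimensional if $X$ has a basis of clopen sets. $\mathcal{B}$ denotes the algebra of clopen subsets of $X$. A coloring is a function $c\colon G\to 2^n$, $n\ge 1$. For $\Sigma\subseteq\mathcal{B}$, $c$ is an externally definable $\Sigma$-coloring if there are $U_0,\dots,U_{n-1}\in\Sigma$ and $y_0,\dots,y_{n-1}\in X$ such that for all $g\in G$, $i<n$: $c(g)(i)=1$ if $y_i\in gU_i$ and $c(g)(i)=0$ if $y_i\notin gU_i$. The ambit has separately finite externally definable Ramsey degree (sep. fin. EDRdeg) if for every finite $\Sigma\subseteq\mathcal{B}$ there is $l\ge 1$ such that for every externally definable $\Sigma$-coloring $c\colon G\to 2^n$ (any $n\geq 1$), every $k\ge 1$ and every $k$-element $A\subseteq G$, there is $h\in G$ with $|c[hA]|\le l$. The Ellis semigroup $E(X)$ is the closure in $X^X$ (product topology) of the set of maps $x\mapsto gx$, $g\in G$, with composition. For a minimal left ideal $\mathcal{M}$ of $E(X)$ and an idempotent $u\in\mathcal{M}$, $u\mathcal{M}$ is a group; its isomorphism type does not depend on $\mathcal{M},u$ and it is called the Ellis group of $X$. It carries the $\tau$-topology: for $a\in E(X)$, $B\subseteq E(X)$ let $a\circ B$ be the set of all limits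 of nets $(g_ib_i)_i$ with $g_i\in G$, $b_i\in B$, $\lim_i g_i=a$; then the closure operator on $u\mathcal{M}$ is $\mathrm{cl}_\tau(B)=u\mathcal{M}\cap(u\circ B)$ for $B\subseteq u\mathcal{M}$. The Ellis group is called profinite if with the $\tau$-topology it is a profinite topological group. *)

(* Defs.v *)
From HB Require Import structures.
From mathcomp Require Import all_boot all_classical topology function_spaces.

Set Implicit Arguments.
Unset Strict Implicit.
Unset Printing Implicit Defensive.

Local Open Scope classical_set_scope.

(* The bare join of a group and a topology: compatibility is the predicate
   [topological_group] below, so that it can be stated of the Ellis group. *)
#[short(type="preTopologicalGroupType")]
HB.structure Definition PreTopologicalGroup := {G of Topological G & Group G}.

Definition topological_group (G : preTopologicalGroupType) : Prop :=
  continuous (fun p : G * G => p.1 * p.2)%g /\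
  continuous (fun g : G => g^-1)%g.

Definition profinite_group (G : preTopologicalGroupType) : Prop :=
  [/\ topological_group G, compact [set: G], hausdorff_space G &
      totally_disconnected [set: G]].

(* Not the library's [zero_dimensional], which only asks that clopen sets
   separate points. *)
Definition has_clopen_basis (X : topologicalType) : Prop :=
  exists2 B : set (set X), basis B & B `<=` clopen.

Section Flows.
Context {G : preTopologicalGroupType} {X : topologicalType}.
Variable act : G -> X -> X.

Record is_flow : Prop := IsFlow {
  flow_topological_group : topological_group G;
  flow_compact : compact [set: X];
  flow_hausdorff : hausdorff_space X;
  flow_act1 : forall x, act 1%g x = x;
  flow_actM : forall g h x, act (g * h)%g x = act g (act h x);
  flow_continuous : continuous (fun p : G * X => act p.1 p.2)
}.

Definition is_ambit (x0 : X) : Prop :=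
  is_flow /\ closure (range (act^~ x0)) = [set: X].

Definition ext_definable_coloring (Sigma : set (set X)) (n : nat)
    (c : G -> {ffun 'I_n -> bool}) : Prop :=
  exists (U : 'I_n -> set X) (y : 'I_n -> X),
    (forall i, Sigma (U i)) /\
    (forall g i, c g i <-> (act g @` U i) (y i)).

Definition sep_fin_EDRdeg : Prop :=
  forall Sigma : set (set X), finite_set Sigma -> Sigma `<=` clopen ->
  exists2 l : nat, (0 < l)%N &
    forall (n : nat) (c : G -> {ffun 'I_n -> bool}), (0 < n)%N ->
      ext_definable_coloring Sigma c ->
    forall (k : nat) (A : set G), (0 < k)%N -> (A #= `I_k)%card ->
    exists h : G, (c @` [set (h * a)%g | a in A] #<= `I_l)%card.

Definition act_ptws (g : G) : {ptws X -> X} := act g.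

Definition ellis_semigroup : set {ptws X -> X} := closure (range act_ptws).

Definition left_ideal (I : set {ptws X -> X}) : Prop :=
  [/\ I !=set0, I `<=` ellis_semigroup &
      forall p q, ellis_semigroup p -> I q -> I (p \o q)].

Definition minimal_left_ideal (M : set {ptws X -> X}) : Prop :=
  left_ideal M /\ forall I, left_ideal I -> I `<=` M -> I = M.

Record directed_order (I : Type) (le : I -> I -> Prop) : Prop :=
  DirectedOrder {
    directed_inhabited : inhabited I;
    directed_refl : forall i, le i i;
    directed_trans : forall j i k, le i j -> le j k -> le i k;
    directed_ub : forall i j, exists2 k, le i k & le j k
  }.

(* The net [u : I -> T] converges to [l] iff [u @ tails le --> l]. *)
Definition tails (I : Type) (le : I -> I -> Prop) : set_system I :=
  filter_from [set: I] (fun i => [set j | le i j]).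

Definition circ (a : {ptws X -> X}) (B : set {ptws X -> X}) :
    set {ptws X -> X} :=
  [set p | exists (I : Type) (le : I -> I -> Prop)
                  (g : I -> G) (b : I -> {ptws X -> X}),
    [/\ directed_order le, forall i, B (b i),
        act_ptws (g i) @[i --> tails le] --> a &
        (act_ptws (g i) \o b i : {ptws X -> X}) @[i --> tails le] --> p]].

Lemma tails_filter (I : Type) (le : I -> I -> Prop) :
  directed_order le -> ProperFilter (tails le).
Proof.
move=> [[i0] refl trans ub]; apply: filter_from_proper; last first.
  by move=> i _; exists i; exact: refl.
apply: filter_from_filter; first by exists i0.
move=> i j _ _; have [k ik jk] := ub i j; exists k => // l kl.
by split; [exact: trans ik kl|exact: trans jk kl].
Qed.

Lemma circP (a : {ptws X -> X}) (B : set {ptws X -> X}) p :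
  circ a B p <->
  forall U V : set {ptws X -> X}, nbhs a U -> nbhs p V ->
    exists g b, [/\ B b, U (act_ptws g) & V (act_ptws g \o b)].
Proof.
split=> [[I [le [g [b [dle Bb ga gp]]]]] U V aU pV|H].
  have FF := tails_filter dle.
  have /filter_ex [i [Ui Vi]] : (tails le)
    ([set i | U (act_ptws (g i))] `&` [set i | V (act_ptws (g i) \o b i)]).
    by apply: filterI; [exact: ga|exact: gp].
  by exists (g i), (b i).
pose P (W : set {ptws X -> X} * set {ptws X -> X}) := nbhs a W.1 /\ nbhs p W.2.
pose I := {W | P W}.
pose le (i j : I) := (sval j).1 `<=` (sval i).1 /\ (sval j).2 `<=` (sval i).2.
have /choice [gb Hgb] : forall i : I, exists gb : G * {ptws X -> X},
    [/\ B gb.2, (sval i).1 (act_ptws gb.1) &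
        (sval i).2 (act_ptws gb.1 \o gb.2)].
  move=> [[U V] /= [aU pV]]; have [g [b [? ? ?]]] := H U V aU pV.
  by exists (g, b).
exists I, le, (fun i => (gb i).1), (fun i => (gb i).2); split.
- split.
  + by constructor; exists (setT, setT); split; exact: filterT.
  + by move=> i; split.
  + by move=> j i k [? ?] [? ?]; split; apply: subset_trans; eassumption.
  + move=> [[U V] /= [aU pV]] [[U' V'] /= [aU' pV']].
    have W : P (U `&` U', V `&` V').
      by split; exact: filterI.
    by exists (exist P _ W); split => /= x [].
- by move=> i; have [] := Hgb i.
- move=> U aU.
  have W : P (U, setT).
    by split=> //; exact: filterT.
  exists (exist P _ W) => // j [jU _]; apply: jU => /=.
  by have [] := Hgb j.
- move=> V pV.
  have W : P (setT, V).
    by split=> //; exact: filterT.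
  exists (exist P _ W) => // j [_ jV]; apply: jV => /=.
  by have [] := Hgb j.
Qed.

End Flows.

Record minimal_idempotent (G : preTopologicalGroupType) (X : topologicalType)
    (act : G -> X -> X) : Type := MinimalIdempotent {
  mi_ideal : set {ptws X -> X};
  mi_idem : {ptws X -> X};
  mi_minimal : minimal_left_ideal act mi_ideal;
  mi_in : mi_ideal mi_idem;
  mi_idempotent : mi_idem \o mi_idem = mi_idem
}.

Section EllisGroup.
Context {G : preTopologicalGroupType} {X : topologicalType} {act : G -> X -> X}.
Variable e : minimal_idempotent act.
Local Notation M := (mi_ideal e).
Local Notation u := (mi_idem e).
Let M_min := mi_minimal e.
Let Mu := mi_in e.
Let uu := mi_idempotent e.

Record ellis_group := EllisGroup {
  ellis_val : {ptws X -> X};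
  ellis_valP : [set u \o p | p in M] ellis_val
}.

HB.instance Definition _ := gen_eqMixin ellis_group.
HB.instance Definition _ := gen_choiceMixin ellis_group.

Implicit Types p q r : ellis_group.

Lemma ellis_val_inj : injective ellis_val.
Proof.
move=> [p Pp] [q Pq] /= pq; rewrite -pq in Pq *.
by congr EllisGroup; exact: Prop_irrelevance.
Qed.

Lemma M_ellis (p : {ptws X -> X}) : M p -> ellis_semigroup act p.
Proof. by case: M_min => -[_ + _ _]; apply. Qed.

Lemma M_comp (f h : {ptws X -> X}) : M f -> M h -> M (f \o h).
Proof. by case: M_min => -[_ ME MM] _ /ME; exact: MM. Qed.

Lemma ellis_val_M p : M (ellis_val p).
Proof. by case: p => _ /= [p Mp <-]; exact: M_comp. Qed.

Lemma ellis_val_u p : u \o ellis_val p = ellis_val p.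
Proof. by case: p => _ /= [p Mp <-]; rewrite compA uu. Qed.

Definition ellis_one : ellis_group :=
  EllisGroup (ex_intro2 _ _ u Mu uu).

Lemma ellis_mul_subproof p q :
  [set u \o r | r in M] (ellis_val p \o ellis_val q).
Proof.
exists (ellis_val p \o ellis_val q); last by rewrite compA ellis_val_u.
by apply: M_comp; exact: ellis_val_M.
Qed.

Definition ellis_mul p q : ellis_group := EllisGroup (ellis_mul_subproof p q).

Lemma ellis_val_ru p : ellis_val p \o u = ellis_val p.
Proof.
case: (M_min) => -[_ ME MM] min.
have /esym : [set f \o u | f in M] = M.
  apply: min; last by move=> _ [f Mf <-]; exact: M_comp.
  split; first by exists (u \o u); exists u.
  - by move=> _ [f Mf <-]; apply: ME; exact: M_comp.
  - by move=> f _ Ef [h Mh <-]; exists (f \o h); [exact: MM|rewrite compA].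
move/seteqP => [+ _] => /(_ _ (ellis_val_M p)) [f Mf <-].
by rewrite -compA uu.
Qed.

Lemma ellis_mulA : associative ellis_mul.
Proof. by move=> p q r; exact: ellis_val_inj. Qed.

Lemma ellis_mul1 : left_id ellis_one ellis_mul.
Proof. by move=> p; apply: ellis_val_inj; exact: ellis_val_u. Qed.

Lemma ellis_mulr1 : right_id ellis_one ellis_mul.
Proof. by move=> p; apply: ellis_val_inj; exact: ellis_val_ru. Qed.

Lemma ellis_has_inv p : exists q, ellis_mul q p = ellis_one.
Proof.
case: (M_min) => -[_ ME MM] min.
have /esym : [set f \o ellis_val p | f in M] = M.
  apply: min; last by move=> _ [f Mf <-]; apply: M_comp => //; exact: ellis_val_M.
  split; first by exists (u \o ellis_val p); exists u.
  - by move=> _ [f Mf <-]; apply: ME; apply: M_comp => //; exact: ellis_val_M.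
  - by move=> f _ Ef [h Mh <-]; exists (f \o h); [exact: MM|rewrite compA].
move/seteqP => [+ _] => /(_ _ Mu) [f Mf fp].
have Mq : [set u \o r | r in M] (u \o f) by exists f.
exists (EllisGroup Mq); apply: ellis_val_inj => /=.
by rewrite -compA fp.
Qed.

Definition ellis_inv p : ellis_group := projT1 (cid (ellis_has_inv p)).

Lemma ellis_mulV : left_inverse ellis_one ellis_inv ellis_mul.
Proof. by move=> p; rewrite /ellis_inv; case: cid. Qed.

Lemma ellis_mulrV : right_inverse ellis_one ellis_inv ellis_mul.
Proof.
move=> p; rewrite -[LHS]ellis_mul1 -(ellis_mulV (ellis_inv p)).
by rewrite -ellis_mulA (ellis_mulA _ p) ellis_mulV ellis_mul1.
Qed.

HB.instance Definition _ := isGroup.Build ellis_group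
  ellis_mulA ellis_mul1 ellis_mulr1 ellis_mulV ellis_mulrV.

Definition tau_closure (B : set ellis_group) : set ellis_group :=
  [set p | circ act u (ellis_val @` B) (ellis_val p)].

(* Closed sets are the [C] with [tau_closure C `<=` C]; [closure_tauE] below
   shows that the resulting closure operator is [tau_closure] itself. *)
Definition tau_open (O : set ellis_group) : Prop := tau_closure (~` O) `<=` ~` O.

Lemma tau_closure0 : tau_closure set0 = set0.
Proof.
apply/seteqP; split=> // p /circP /(_ setT setT filterT filterT).
by move=> [g [b [[]]]].
Qed.

Lemma tau_closureS B C : B `<=` C -> tau_closure B `<=` tau_closure C.
Proof.
move=> BC p /circP H; apply/circP => U V aU pV.
have [g [_ [[b Bb <-] ? ?]]] := H U V aU pV.
by exists g, (ellis_val b); split=> //; exists b => //; exact: BC.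
Qed.

Lemma tau_closureU B C :
  tau_closure (B `|` C) `<=` tau_closure B `|` tau_closure C.
Proof.
move=> p /circP H; apply: contrapT => /not_orP [].
rewrite /tau_closure /= => /circP NB /circP NC.
have {NB} [U [V [aU pV NB]]] : exists U V : set {ptws X -> X},
    [/\ nbhs u U, nbhs (ellis_val p) V & forall g b, B b ->
     U (act_ptws act g) -> V (act_ptws act g \o ellis_val b) -> False].
  apply: contrapT => NH; apply: NB => U V aU pV; apply: contrapT => NE.
  apply: NH; exists U, V; split=> // g b Bb Ug Vg; apply: NE.
  by exists g, (ellis_val b); split=> //; exists b.
have {NC} [U' [V' [aU' pV' NC]]] : exists U V : set {ptws X -> X},
    [/\ nbhs u U, nbhs (ellis_val p) V & forall g b, C b ->
     U (act_ptws act g) -> V (act_ptws act g \o ellis_val b) -> False].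
  apply: contrapT => NH; apply: NC => W V0 aW pV0; apply: contrapT => NE.
  apply: NH; exists W, V0; split=> // g b Bb Ug Vg; apply: NE.
  by exists g, (ellis_val b); split=> //; exists b.
have [g [_ [[b BCb <-] [Ug U'g] [Vg V'g]]]] :=
  H (U `&` U') (V `&` V') (filterI aU aU') (filterI pV pV').
by case: BCb => [Bb|Cb]; [exact: NB Bb Ug Vg|exact: NC Cb U'g V'g].
Qed.

Lemma tau_openT : tau_open setT.
Proof. by rewrite /tau_open setCT tau_closure0. Qed.

Lemma tau_openI : setI_closed tau_open.
Proof.
by move=> A B oA oB p; rewrite setCI => /tau_closureU [/oA|/oB]; [left|right].
Qed.

Lemma tau_open_bigU (I : Type) (F : I -> set ellis_group) :
  (forall i, tau_open (F i)) -> tau_open (\bigcup_i F i).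
Proof.
move=> oF p pF [i _ Fip]; apply: (oF i p) Fip.
by apply: tau_closureS pF => q NF Fiq; apply: NF; exists i.
Qed.

HB.instance Definition _ :=
  isOpenTopological.Build ellis_group tau_openT tau_openI tau_open_bigU.

Lemma ptws_cvgP (F : set_system {ptws X -> X}) (f : {ptws X -> X}) :
  Filter F -> F --> f <-> forall x, g x @[g --> F] --> f x.
Proof.
move=> FF; split=> [Ff x V fxV|H].
  have : nbhs f ((fun g : {ptws X -> X} => g x) @^-1` V) by exact: proj_continuous.
  exact: Ff.
apply/cvg_sup => x U [_ [[W oW <-] Wfx] WU].
by apply: filterS WU _; apply: (H x W); exact: open_nbhs_nbhs.
Qed.

Lemma ptws_compr_continuous (b : {ptws X -> X}) :
  continuous (fun f : {ptws X -> X} => f \o b : {ptws X -> X}).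
Proof.
move=> f; have FF := fmap_filter (fun f : {ptws X -> X} => f \o b) (nbhs_filter f).
by apply/(ptws_cvgP _ FF) => x; apply: (ptws_cvgP f (nbhs_filter f)).1.
Qed.

Lemma ptws_act_continuous (g : G) : is_flow act ->
  continuous (fun f : {ptws X -> X} => act_ptws act g \o f : {ptws X -> X}).
Proof.
move=> Fl f.
have FF := fmap_filter (fun f : {ptws X -> X} => act_ptws act g \o f) (nbhs_filter f).
apply/(ptws_cvgP _ FF) => x.
have fx : h x @[h --> f] --> f x by apply: (ptws_cvgP f (nbhs_filter f)).1.
have cg : {for f x, continuous (act g)}.
  apply: (@continuous_comp _ _ _ (fun y => (g, y)) (fun q : G * X => act q.1 q.2)).
    by apply: cvg_pair; [exact: cvg_cst|exact: cvg_id].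
  exact: flow_continuous Fl _.
exact: cvg_comp fx cg.
Qed.

Lemma closed_tauE (C : set ellis_group) : closed C <-> tau_closure C `<=` C.
Proof.
have -> : tau_closure C `<=` C <-> open (~` C) by rewrite /open /= /tau_open setCK.
by split=> [/closed_openC|/open_closedC]; rewrite ?setCK.
Qed.

Lemma sub_tau_closure (B : set ellis_group) : B `<=` tau_closure B.
Proof.
move=> p Bp; apply/circP => U V uU pV.
have uV : nbhs u [set f : {ptws X -> X} | V (f \o ellis_val p)].
  by apply: ptws_compr_continuous; rewrite /= ellis_val_u.
have [_ [[g _ <-] [Ug Vg]]] := M_ellis Mu (filterI uU uV).
by exists g, (ellis_val p); split=> //; exists p.
Qed.

Lemma tau_closure_idem (B : set ellis_group) :
  is_flow act -> tau_closure (tau_closure B) `<=` tau_closure B.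
Proof.
move=> Fl p /circP H; apply/circP => U V; rewrite nbhsE => -[U' [oU' U'u] UU'].
rewrite nbhsE => -[V' [oV' V'p] VV'].
have uU : nbhs u [set f : {ptws X -> X} | U' (f \o u)].
  apply: ptws_compr_continuous; rewrite /= uu.
  exact: open_nbhs_nbhs.
have pV : nbhs (ellis_val p) V' by exact: open_nbhs_nbhs.
have [g [_ [[q /circP qB <-] gU gV]]] := H _ _ uU pV.
have uU2 : nbhs u [set f : {ptws X -> X} | U' (act_ptws act g \o f)].
  by apply: ptws_act_continuous => //; exact: open_nbhs_nbhs.
have qV2 : nbhs (ellis_val q) [set f : {ptws X -> X} | V' (act_ptws act g \o f)].
  by apply: ptws_act_continuous => //; exact: open_nbhs_nbhs.
have [h [b [Bb hU hV]]] := qB _ _ uU2 qV2.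
have ghE : act_ptws act (g * h)%g = act_ptws act g \o act_ptws act h.
  by apply/funext => x; exact: flow_actM Fl _ _ _.
exists (g * h)%g, b; split=> //; rewrite ghE; first exact: UU'.
by apply: VV'; rewrite -compA.
Qed.

Lemma closure_tauE (B : set ellis_group) :
  is_flow act -> closure B = tau_closure B.
Proof.
move=> Fl; rewrite closureE; apply/seteqP; split.
  apply: smallest_sub; last exact: sub_tau_closure.
  by apply/closed_tauE; exact: tau_closure_idem.
move=> p pB C [/closed_tauE cC BC]; apply: cC.
exact: tau_closureS pB.
Qed.

End EllisGroup.

(* Main.v *)
Require Import Defs.
From mathcomp Require Import all_boot all_classical topology function_spaces.

Set Implicit Arguments.
Unset Strict Implicit.
Unset Printing Implicit Defensive.

Local Open Scope classical_set_scope.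

(** For a clopen [U], call two points of [X] indistinguishable when no translate
of [U] separates them.  This is the kernel of the factor map
[x |-> {g | g x \in U}] from [X] to a subflow of [2^G], and every element of
[E(X)] preserves it.

The Ramsey hypothesis, applied to the single set [U], is turned by a limit over
the finite subsets of [G] and of [X] into an element [eta] of [E(X)] whose image
meets only finitely many indistinguishability classes
([ramsey_finite_image]).  In a group [u M], the identity [u] factors as
[(u eta u) (u eta u)^-1], so [u] has finite image modulo indistinguishability as
well, and since [p = u p u] for each [p] in [u M], the group [u M] has only
finitely many classes for the pointwise relation [ellis_class U]: the class of
[p] is the permutation that [p] induces on the finite set of indistinguishability
classes met by the image of [u].

Each class is tau-closed ([ellis_class_closed]), hence clopen, there being
finitely many.  The classes separate points because the clopen sets of [X] do.
The tau-topology is always compact ([tau_compact]), so a filter on [u M]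
converges to [p] as soon as it contains every class of [p]
([ellis_class_cvg]).  The classes are congruences, whence the continuity of the
group operations; being clopen and separating, they make [u M] Hausdorff and
totally disconnected. *)

Section Indistinguishability.
Context {G : preTopologicalGroupType} {X : topologicalType}.
Variable act : G -> X -> X.
Hypothesis flow_act : is_flow act.

(** * Indistinguishability *)

Definition indist (U : set X) (x y : X) : Prop :=
  forall g, U (act g x) <-> U (act g y).

Lemma indist_sym U x y : indist U x y -> indist U y x.
Proof. by move=> H g; split=> /H. Qed.

Lemma indist_trans U y x z : indist U x y -> indist U y z -> indist U x z.
Proof. by move=> H K g; split=> [/H /K|/K /H]. Qed.

Lemma act_continuous g : continuous (act g).
Proof.
move=> x; apply: (@continuous_comp _ _ _ (fun y => (g, y))
  (fun q : G * X => act q.1 q.2)); last exact: flow_continuous flow_act _.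
by apply: cvg_pair; [exact: cvg_cst|exact: cvg_id].
Qed.

Lemma nbhs_eval_clopen (U : set X) (f : {ptws X -> X}) g x : clopen U ->
  nbhs f [set h : {ptws X -> X} | U (act g (h x)) <-> U (act g (f x))].
Proof.
move=> cU.
have evalP V : clopen V -> V (f x) -> nbhs f [set h : {ptws X -> X} | V (h x)].
  move=> [oV _] Vfx.
  have fx : h x @[h --> f] --> f x by exact: proj_continuous.
  by apply: (fx V); exact: open_nbhs_nbhs.
have cV : clopen (act g @^-1` U).
  by apply: preimage_clopen => //; exact: act_continuous.
have [Ufx|NUfx] := pselect (U (act g (f x))).
  by apply: filterS (evalP _ cV Ufx) => h /= Uh.
by apply: filterS (evalP (~` (act g @^-1` U)) (clopenC set0 cV) NUfx) => h.
Qed.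

(** Each instance of indistinguishability is a conjunction of clopen conditions
on the values of a map, and translations satisfy all of them. *)
Lemma ellis_indist U p x y : clopen U -> ellis_semigroup act p ->
  indist U x y -> indist U (p x) (p y).
Proof.
move=> cU Ep xy g.
have [_ [[h _ <-] [/= Hx Hy]]] :=
  Ep _ (filterI (nbhs_eval_clopen p g x cU) (nbhs_eval_clopen p g y cU)).
rewrite -Hx -Hy /act_ptws -!(flow_actM flow_act).
exact: xy.
Qed.

Lemma ellis_compact : compact (ellis_semigroup act).
Proof.
have cT : compact [set: {ptws X -> X}].
  have := @tychonoff X (fun=> X) (fun=> setT) (fun=> flow_compact flow_act).
  by congr compact; apply/seteqP; split.
by apply: (subclosed_compact _ cT) => //; exact: closed_closure.
Qed.

(** * The limit of the Ramsey property *)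

Lemma ultra_fin (I : Type) (F : set_system I) (T : finType) (f : I -> T) :
  UltraFilter F -> exists t, F [set i | f i = t].
Proof.
move=> FU; apply: contrapT => NF.
have : \forall i \near F, forall t, f i <> t.
  apply: filter_forall => t.
  have [Ft|//] := in_ultra_setVsetC [set i | f i = t] FU.
  by case: NF; exists t.
by move=> /filter_ex [i /(_ (f i))].
Qed.

(** A translate of [A] with few colors, read as a coloring [k] of [G] that
governs, on [A], the positions of the finitely many points [h^-1 y]. *)
Lemma finite_homogeneous (U : set X) (l : nat) (l_gt0 : (0 < l)%N) (x0 : X) :
  (forall (n : nat) (c : G -> {ffun 'I_n -> bool}), (0 < n)%N ->
      ext_definable_coloring act [set U] c ->
    forall (k : nat) (A : set G), (0 < k)%N -> (A #= `I_k)%card ->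
    exists h : G, (c @` [set (h * a)%g | a in A] #<= `I_l)%card) ->
  forall (A : seq G) (Y : seq X), exists (h : G) (k : G -> 'I_l),
  forall a b y, a \in A -> b \in A -> y \in Y -> k a = k b ->
    (U (act a^-1%g (act h^-1%g y)) <-> U (act b^-1%g (act h^-1%g y))).
Proof.
move=> ramsey A Y.
(* the extra entries only ensure that the two lists are nonempty *)
pose Y' := x0 :: Y; pose A' := 1%g :: A.
pose c g := [ffun i : 'I_(size Y') => `[< U (act g^-1%g (nth x0 Y' i)) >]].
have c_ext : ext_definable_coloring act [set U] c.
  exists (fun=> U), (fun i => nth x0 Y' i); split=> // g i; rewrite ffunE.
  split=> [/asboolP Ui|[z Uz zE]].
    exists (act g^-1%g (nth x0 Y' i)) => //.
    by rewrite -(flow_actM flow_act) mulgV (flow_act1 flow_act).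
  apply/asboolP; rewrite -zE.
  by rewrite -(flow_actM flow_act) mulVg (flow_act1 flow_act).
have /finite_setP [m A'm] := finite_seq A'.
have m_gt0 : (0 < m)%N.
  case: m A'm => //; rewrite II0 card_eq0 => /eqP A'0.
  have : [set` A'] 1%g by rewrite /= mem_head.
  by rewrite A'0.
have [h /pcard_leP/injfunPex [f fl finj]] := ramsey _ c isT c_ext _ _ m_gt0 A'm.
exists h, (fun a => insubd (Ordinal l_gt0) (f (c (h * a)%g))).
move=> a b y aA bA yY /(congr1 val).
have colP z : z \in A -> (c @` [set (h * a)%g | a in [set` A']]) (c (h * z)%g).
  move=> zA; exists (h * z)%g => //; exists z => //=.
  by rewrite inE zA orbT.
rewrite !val_insubd (fl _ (colP a aA)) (fl _ (colP b bA)).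
move=> /finj; rewrite !inE => /(_ (colP a aA) (colP b bA)) cab.
have yY' : y \in Y' by rewrite inE yY orbT.
have iY : (index y Y' < size Y')%N by rewrite index_mem.
have := congr1 (fun w : {ffun 'I_(size Y') -> bool} => w (Ordinal iY)) cab.
rewrite !ffunE /= -/Y' nth_index // !invgM !(flow_actM flow_act) => E.
by split=> /asboolP; [rewrite E|rewrite -E] => /asboolP.
Qed.

(** Along an ultrafilter, the colorings of [finite_homogeneous] become a coloring
[k] of all of [G] with [l] colors, and the translations by [h^-1] accumulate at
some [eta].  Whether [eta y] lies in [g U] then depends on the color of [g] only,
so [l] bits determine the class of [eta y]. *)
Lemma ramsey_finite_image (x0 : X) U : sep_fin_EDRdeg act -> clopen U ->
  exists (eta : {ptws X -> X}) (T : finType) (phi : X -> T),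
    ellis_semigroup act eta /\
    forall y z, phi y = phi z -> indist U (eta y) (eta z).
Proof.
move=> edr cU.
have [|l l_gt0 ramsey] := edr [set U] (finite_set1 U); first by move=> _ ->.
pose I := (seq G * seq X)%type.
have /choice [hk Hhk] : forall i : I, exists hk : G * (G -> 'I_l),
    forall a b y, a \in i.1 -> b \in i.1 -> y \in i.2 -> hk.2 a = hk.2 b ->
    (U (act a^-1%g (act hk.1^-1%g y)) <-> U (act b^-1%g (act hk.1^-1%g y))).
  move=> [A Y]; have [h [k H]] := finite_homogeneous l_gt0 x0 ramsey A Y.
  by exists (h, k).
pose le (i j : I) := {subset i.1 <= j.1} /\ {subset i.2 <= j.2}.
have dle : directed_order le.
  split.
  - by constructor; exact: ([::], [::]).
  - by move=> i; split.
  - by move=> j i k [ij1 ij2] [jk1 jk2]; split=> z; [move/ij1/jk1|move/ij2/jk2].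
  - move=> i j; exists (i.1 ++ j.1, i.2 ++ j.2); split=> z /= zi;
      by rewrite mem_cat zi ?orbT.
have TF := tails_filter dle.
have [F [FU tailsF]] := ultraFilterLemma TF.
have /choice [k Hk] : forall g, exists t, F [set i | (hk i).2 g = t].
  by move=> g; exact: ultra_fin.
pose T i := act_ptws act (hk i).1^-1%g.
have [eta [Eeta Ceta]] : ellis_semigroup act `&` cluster (T @ F) !=set0.
  apply: ellis_compact; apply: (@filterE _ F) => i.
  by apply: subset_closure; exists (hk i).1^-1%g.
have kP g g' y : k g = k g' -> U (act g^-1%g (eta y)) <-> U (act g'^-1%g (eta y)).
  move=> kgg'.
  have Fi : (T @ F) [set f : {ptws X -> X} |
      U (act g^-1%g (f y)) <-> U (act g'^-1%g (f y))].
    have Ft : F [set i | le ([:: g; g'], [:: y]) i].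
      by apply: tailsF; exists ([:: g; g'], [:: y]).
    apply: (@filterS _ F _ _ _ _ (filterI Ft (filterI (Hk g) (Hk g')))).
    move=> i [[/= sg sy] [kg kg']]; apply: Hhk.
    + by apply: sg; rewrite mem_head.
    + by apply: sg; rewrite !inE eqxx orbT.
    + by apply: sy; rewrite mem_head.
    + by rewrite kg kg'.
  have [f [/= E [/= <- <-]]] := Ceta _ _ Fi (filterI
    (nbhs_eval_clopen eta g^-1%g y cU) (nbhs_eval_clopen eta g'^-1%g y cU)).
  exact: E.
exists eta, {ffun 'I_l -> bool}.
exists (fun y => [ffun t => `[< exists2 g, k g = t & U (act g^-1%g (eta y)) >]]).
split=> // y z yz.
suff dir v w g : [ffun t => `[< exists2 g, k g = t & U (act g^-1%g (eta v)) >]]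
    = [ffun t => `[< exists2 g, k g = t & U (act g^-1%g (eta w)) >]] ->
    U (act g (eta v)) -> U (act g (eta w)).
  by move=> g; split; exact: dir.
move=> /ffunP /(_ (k g^-1%g)); rewrite !ffunE => E Uv.
have : `[< exists2 h, k h = k g^-1%g & U (act h^-1%g (eta v)) >].
  by apply/asboolP; exists g^-1%g => //; rewrite invgK.
by rewrite E => /asboolP [h /kP ->]; rewrite invgK.
Qed.

End Indistinguishability.

Section EllisClasses.
Context {G : preTopologicalGroupType} {X : topologicalType} {act : G -> X -> X}.
Hypothesis flow_act : is_flow act.
Variable e : minimal_idempotent act.
Local Notation M := (mi_ideal e).
Local Notation u := (mi_idem e).
Implicit Types (p q r : ellis_group e) (U : set X).

(** * Finitely many classes in the Ellis group *)

Definition ellis_class U p : set (ellis_group e) :=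
  [set q | forall x, indist act U (ellis_val q x) (ellis_val p x)].

Lemma ellis_val_ellis p : ellis_semigroup act (ellis_val p).
Proof. exact: M_ellis (ellis_val_M p). Qed.

Lemma ellis_val_uE p x : u (ellis_val p x) = ellis_val p x.
Proof. by have /(congr1 (fun f => f x)) := (ellis_val_u p). Qed.

Lemma ellis_val_ruE p x : ellis_val p (u x) = ellis_val p x.
Proof. by have /(congr1 (fun f => f x)) := (ellis_val_ru p). Qed.

Lemma ellis_class_mul U p p' q q' : clopen U ->
  ellis_class U p p' -> ellis_class U q q' -> ellis_class U (p * q)%g (p' * q')%g.
Proof.
move=> cU pp' qq' x /=; apply: indist_trans (pp' _) _.
by apply: ellis_indist => //; exact: ellis_val_ellis.
Qed.

Lemma ellis_class_inv U p q : clopen U ->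
  ellis_class U p q -> ellis_class U p^-1%g q^-1%g.
Proof.
move=> cU pq.
have /(ellis_class_mul cU) H : ellis_class U q^-1%g q^-1%g by [].
have /(_ p^-1%g p^-1%g) := ellis_class_mul cU (H _ _ pq).
rewrite mulVg mul1g -mulgA mulgV mulg1 => K x.
by apply: indist_sym; apply: K.
Qed.

(** The witness [w = u eta u] lies in [u M] and [u = w w^-1], so the image of [u]
is no larger than that of [w]; and [w] factors through [eta]. *)
Lemma idem_finite_image U (eta : {ptws X -> X}) (T : finType) (phi : X -> T) :
    clopen U -> ellis_semigroup act eta ->
    (forall y z, phi y = phi z -> indist act U (eta y) (eta z)) ->
  exists psi : X -> T,
    forall y z, psi y = psi z -> indist act U (u y) (u z).
Proof.
move=> cU Eeta H; have [[_ _ MM] _] := mi_minimal e.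
have Pw : [set u \o p | p in M] (u \o (eta \o u)).
  by exists (eta \o u) => //; apply: MM => //; exact: mi_in.
pose w : ellis_group e := EllisGroup Pw.
have uE x : u x = u (eta (u (ellis_val w^-1%g x))).
  by have /(congr1 (fun p => ellis_val p x)) := mulgV w.
exists (fun y => phi (u (ellis_val w^-1%g y))) => y z /H yz.
rewrite (uE y) (uE z); apply: ellis_indist => //.
exact: M_ellis (mi_in e).
Qed.

(** As [p = u p u], the class of [p] is determined by the classes of the points
[p r], for [r] ranging over representatives of the fibers of [phi]. *)
Lemma ellis_class_finite U (T : finType) (phi : X -> T) (x0 : X) :
    clopen U -> (forall y z, phi y = phi z -> indist act U (u y) (u z)) ->
  exists (S : finType) (psi : ellis_group e -> S),
    forall p q, psi p = psi q -> ellis_class U p q.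
Proof.
move=> cU H.
have /choice [r rP] : forall t, exists y, forall z, phi z = t -> phi y = t.
  move=> t; have [[y yt]|N] := pselect (exists y, phi y = t).
    by exists y.
  by exists x0 => z zt; case: N; exists z.
exists {ffun T -> T}, (fun p => [ffun t => phi (ellis_val p (r t))]).
move=> p q /ffunP pq x.
have val_r (s : ellis_group e) : indist act U (ellis_val s x) (ellis_val s (r (phi x))).
  rewrite -(ellis_val_ruE s x) -(ellis_val_ruE s (r _)); apply: ellis_indist => //.
    exact: ellis_val_ellis.
  by apply: H; rewrite (rP _ x).
apply: indist_trans (val_r q) _.
apply: indist_trans _ (indist_sym (val_r p)).
have := pq (phi x); rewrite !ffunE => /H.
by rewrite !ellis_val_uE => E; exact: indist_sym.
Qed.

(** * The tau-topology *)

(** If [g_i -> u] and [b_i] are all equivalent to [p], then [g_i b_i x] is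
indistinguishable from [g_i (p x)], which tends to [u (p x) = p x]. *)
Lemma ellis_class_closed U p : clopen U -> closed (ellis_class U p).
Proof.
move=> cU; apply/closed_tauE => q /circP H x g.
have [h [_ [[b bp <-] /= Hu Hq]]] := H _ _
  (nbhs_eval_clopen flow_act u g (ellis_val p x) cU)
  (nbhs_eval_clopen flow_act (ellis_val q) g x cU).
rewrite -(ellis_val_uE p) -Hu -Hq /act_ptws /= -!(flow_actM flow_act).
exact: bp.
Qed.

Lemma ellis_class_clopen U p (S : finType) (psi : ellis_group e -> S) :
    clopen U -> (forall q r, psi q = psi r -> ellis_class U q r) ->
  clopen (ellis_class U p).
Proof.
move=> cU H; split; last exact: ellis_class_closed.
rewrite -[ellis_class U p]setCK; apply: closed_openC.
pose D := [set s | exists2 q, psi q = s & ~ ellis_class U p q].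
have /choice [rep repP] : forall s, exists q, D s -> psi q = s /\ ~ ellis_class U p q.
  move=> s; have [[q qs Nq]|N] := pselect (D s); first by exists q.
  by exists p.
have -> : ~` ellis_class U p = \bigcup_(s in D) ellis_class U (rep s).
  apply/seteqP; split=> q.
    move=> Nq; have Dq : D (psi q) by exists q.
    by exists (psi q) => //; apply: H; case: (repP _ Dq).
  move=> [s Ds sq] pq; have [_] := repP _ Ds; apply => x.
  exact: indist_trans (indist_sym (sq x)) (pq x).
apply: closed_bigcup; first exact: finite_finset.
by move=> s _; exact: ellis_class_closed.
Qed.

(** If a filter on [u M] accumulates at [p] in [E(X)], it tau-accumulates at
[u p u]: when [g] is near [u] with [g p u] near [u p u], also [g b = g b u] is
near [u p u] for all [b] of [u M] near [p]. *)
Lemma tau_compact : compact [set: ellis_group e].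
Proof.
move=> F FF _.
have [p [Ep Cp]] : ellis_semigroup act `&`
    cluster ((@ellis_val _ _ _ e) @ F) !=set0.
  by apply: (ellis_compact flow_act); apply: (@filterE _ F) => q; exact: ellis_val_ellis.
have [[_ _ MM] _] := mi_minimal e.
have Pq : [set u \o p | p in M] (u \o (p \o u)).
  by exists (p \o u) => //; apply: MM => //; exact: mi_in.
exists (EllisGroup Pq); split=> //; rewrite clusterE => B FB.
rewrite (closure_tauE _ flow_act); apply/circP => U V uU.
rewrite nbhsE => -[V' [oV' V'q] VV'].
have uV : nbhs u [set f : {ptws X -> X} | V' (f \o (p \o u))].
  by apply: ptws_compr_continuous; exact: open_nbhs_nbhs.
have [_ [[g _ <-] [Ug Vg]]] := M_ellis (mi_in e) (filterI uU uV).
have pV : nbhs p [set f : {ptws X -> X} | V' (act_ptws act g \o (f \o u))].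
  have pV1 : nbhs (p \o u : {ptws X -> X})
      [set f : {ptws X -> X} | V' (act_ptws act g \o f)].
    by apply: ptws_act_continuous => //; exact: open_nbhs_nbhs.
  exact: (@ptws_compr_continuous X u p _ pV1).
have FB' : ((@ellis_val _ _ _ e) @ F) (@ellis_val _ _ _ e @` B).
  by apply: (@filterS _ F _ _ _ _ FB) => b Bb; exists b.
have [_ [[b Bb <-] /= Vb]] := Cp _ _ FB' pV.
exists g, (ellis_val b); split=> //; first by exists b.
by apply: VV'; rewrite -(ellis_val_ru b).
Qed.

Hypothesis class_clopen : forall U p, clopen U -> clopen (ellis_class U p).
Hypothesis clopen_separates :
  forall x y : X, x <> y -> exists U, [/\ clopen U, U x & ~ U y].

Lemma ellis_class_separates p q : p <> q ->
  exists2 U, clopen U & ~ ellis_class U p q.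
Proof.
move=> pq.
have [x xpq] : exists x, ellis_val p x <> ellis_val q x.
  apply: contrapT => N; apply: pq; apply: ellis_val_inj; apply/funext => x.
  by apply: contrapT => xpq; apply: N; exists x.
have [U [cU Ux NUx]] := clopen_separates xpq.
exists U => // /(_ x 1%g); rewrite !(flow_act1 flow_act) => E.
by apply: NUx; rewrite E.
Qed.

Lemma ellis_zero_dimensional : zero_dimensional (ellis_group e).
Proof.
move=> p q /eqP /ellis_class_separates [U cU Npq].
by exists (ellis_class U p); split=> //; exact: class_clopen.
Qed.

Lemma ellis_hausdorff : hausdorff_space (ellis_group e).
Proof.
move=> p q pq; apply: contrapT => /eqP.
move=> /ellis_zero_dimensional [A [[oA cA] Ap NAq]].
have Ap' : nbhs p A by exact: open_nbhs_nbhs.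
have Aq' : nbhs q (~` A).
  by apply: open_nbhs_nbhs; split=> //; exact: closed_openC.
by have [r [Ar]] := pq _ _ Ap' Aq'.
Qed.

(** Such a filter has no accumulation point other than [p]: the classes of [p] are
closed and their intersection is [p].  Compactness does the rest. *)
Lemma ellis_class_cvg (F : set_system (ellis_group e)) p : ProperFilter F ->
  (forall U, clopen U -> F (ellis_class U p)) -> F --> p.
Proof.
move=> FF Fp.
have sub : cluster F `<=` [set p].
  move=> q; rewrite clusterE => Fq; apply: contrapT => /= qp.
  have [U cU] := ellis_class_separates (fun pq : p = q => qp (esym pq)).
  by apply; have /closure_id -> := @ellis_class_closed U p cU; apply: Fq; exact: Fp.
apply: (compact_cluster_set1 ellis_hausdorff tau_compact) => //; try exact: filterT.
apply/seteqP; split=> // _ ->.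
have [q [_ Fq]] := tau_compact FF filterT.
by rewrite -(sub q Fq).
Qed.

Lemma ellis_topological_group : topological_group (ellis_group e).
Proof.
have nbhs_class U p : clopen U -> nbhs p (ellis_class U p).
  by move=> cU; apply: open_nbhs_nbhs; split=> //; exact: (class_clopen _ cU).1.
split=> [[p q]|p].
  apply: ellis_class_cvg => U cU.
  exists (ellis_class U p, ellis_class U q) => /=.
    by split; exact: nbhs_class.
  by move=> [p' q'] [/= pp' qq']; exact: ellis_class_mul.
apply: (ellis_class_cvg (fmap_proper_filter _ (nbhs_pfilter p))) => U cU.
by apply: filterS (nbhs_class U p cU) => q; exact: ellis_class_inv.
Qed.

End EllisClasses.

Lemma clopen_basis_separates (X : topologicalType) :
  has_clopen_basis X -> hausdorff_space X ->
  forall x y : X, x <> y -> exists U, [/\ clopen U, U x & ~ U y].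
Proof.
move=> [B [_ Bnbhs] Bcl] hX x y xy.
apply: contrapT => N; apply: xy; apply: hX => A C xA yC.
have [U [BU Ux] UA] := Bnbhs x _ xA.
have Uy : U y.
  by apply: contrapT => NUy; apply: N; exists U; split=> //; exact: Bcl.
by exists y; split; [exact: UA|exact: nbhs_singleton].
Qed.

Theorem corollary3p19 (G : preTopologicalGroupType) (X : topologicalType)
    (act : G -> X -> X) (x0 : X)
    (ambit_X : is_ambit act x0)
    (X_0dim : has_clopen_basis X)
    (X_EDRdeg : sep_fin_EDRdeg act)
    (e : minimal_idempotent act) :
  profinite_group (ellis_group e).
Proof.
have [Fl _] := ambit_X.
have sepX := clopen_basis_separates X_0dim (flow_hausdorff Fl).
have class_clopen U (p : ellis_group e) : clopen U -> clopen (ellis_class U p).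
  move=> cU.
  have [eta [T [phi [Eeta etaP]]]] := ramsey_finite_image Fl x0 X_EDRdeg cU.
  have [psi psiP] := idem_finite_image Fl e cU Eeta etaP.
  have [S [chi chiP]] := ellis_class_finite Fl x0 cU psiP.
  exact: ellis_class_clopen cU chiP.
split.
- exact: (ellis_topological_group Fl class_clopen sepX).
- exact: tau_compact.
- exact: (ellis_hausdorff Fl class_clopen sepX).
- apply: zero_dimension_totally_disconnected.
  exact: (ellis_zero_dimensional Fl class_clopen sepX).
Qed.
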